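(* Let $A$ be a unital Banach algebra with unit element $1_A$, and let $(C(t))_{t\in\mathbb{R}}$ be a cosine function in $A$. If $\limsup_{t\to 0}\Vert C(t)-1_A\Vert<2$, then $\limsup_{t\to 0}\Vert C(t)-1_A\Vert=0$.
   Context: Banach algebras are over $\mathbb{C}$. A cosine function in a unital Banach algebra $A$ with unit $1_A$ is a family $(C(t))_{t\in\mathbb{R}}$ of elements of $A$ such that $C(0)=1_A$ and $C(s+t)+C(s-t)=2C(s)C(t)$ for all $s,t\in\mathbb{R}$. No continuity or measurability of $t\mapsto C(t)$ is assumed. *)

(* Defs.v *)
From HB Require Import structures.
From mathcomp Require Import all_boot all_order all_algebra.
From mathcomp Require Import complex.
From mathcomp Require Import all_classical all_reals all_analysis.

Set Implicit Arguments.
Unset Strict Implicit.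
Unset Printing Implicit Defensive.

Import Order.TTheory GRing.Theory Num.Theory.
Import numFieldNormedType.Exports.

Local Open Scope ring_scope.
Local Open Scope complex_scope.

(* HB refuses to join CompleteNormedModule with GRing.Algebra: NumDomain      *)
(* already inherits from both a ring and a normed Z-module and would have to  *)
(* be redeclared. The product is therefore introduced here, and the ring      *)
(* structure is derived from it below.                                        *)
(* Neither `|1| = 1 nor 1 != 0 is required.                                   *)
HB.mixin Record CompleteNormedModule_isBanachAlgebra
    (K : numFieldType) A of CompleteNormedModule K A := {
  banach_one : A;
  banach_mul : A -> A -> A;
  banach_mulA : associative banach_mul;
  banach_mul1x : left_id banach_one banach_mul;
  banach_mulx1 : right_id banach_one banach_mul;
  banach_mulDl : left_distributive banach_mul +%R;
  banach_mulDr : right_distributive banach_mul +%R;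
  banach_scaleAl : forall (k : K) (x y : A),
    k *: banach_mul x y = banach_mul (k *: x) y;
  banach_scaleAr : forall (k : K) (x y : A),
    k *: banach_mul x y = banach_mul x (k *: y);
  banach_normM : forall x y : A, `|banach_mul x y| <= `|x| * `|y|
}.

#[short(type="banachAlgType")]
HB.structure Definition BanachAlgebra (K : numFieldType) :=
  {A of CompleteNormedModule K A & CompleteNormedModule_isBanachAlgebra K A}.

HB.instance Definition _ (K : numFieldType) (A : banachAlgType K) :=
  GRing.Zmodule_isPzRing.Build (BanachAlgebra.sort A)
    banach_mulA banach_mul1x banach_mulx1 banach_mulDl banach_mulDr.

Definition cosine_function (R : realType) (A : pzRingType) (C : R -> A) : Prop :=
  C 0 = 1 /\ forall s t : R, C (s + t) + C (s - t) = 2 * C s * C t.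

(* In a normed module over R[i] the norm takes its values in R[i]; rnorm is   *)
(* the same norm seen as a real number, see rnormE.                           *)
Definition rnorm (R : realType) (V : normedModType R[i]) (x : V) : R :=
  complex.Re `|x|.

Lemma rnormE (R : realType) (V : normedModType R[i]) (x : V) :
  (rnorm x)%:C = `|x|.
Proof. by rewrite /rnorm RRe_real// normr_real. Qed.

Section BanachAlgebraTheory.
Variables (K : numFieldType) (A : banachAlgType K).
Implicit Types (k : K) (x y : A).

Lemma banach_scalerAl k x y : k *: (x * y) = (k *: x) * y.
Proof. exact: banach_scaleAl. Qed.

Lemma banach_scalerAr k x y : k *: (x * y) = x * (k *: y).
Proof. exact: banach_scaleAr. Qed.

Lemma banach_normrM x y : `|x * y| <= `|x| * `|y|.
Proof. exact: banach_normM. Qed.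

End BanachAlgebraTheory.

(* Main.v *)
(* Write X_j = 2 (1 - C(j t)). As a 2k-th difference of C, the power X_j ^ k
   is the sum over |m| <= k of (-1)^m binom(2k, k + m) C(m j t). Multiply by
   y = 2 (1 - C(k! t)) and average over 0 <= j < M. Since m divides k! for
   1 <= |m| <= k, the sum over j of y C(j (m t)) telescopes, so these terms are
   O(1/M) and only m = 0 survives:
     binom(2k, k) y = (1/M) sum_j y X_j ^ k + O(1/M).
   If ||1 - C|| <= rho <= r < 2 near 0, the right-hand side is at most
   2 rho ((2 r) ^ k + O(1/M)), and (2 r) ^ k is small compared with
   binom(2k, k) >= 4 ^ k / (2k + 1) for k large. Hence, on a neighbourhood
   smaller by a factor depending on r only, ||1 - C|| <= rho / 2; iterate. *)
Require Import Defs.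
From HB Require Import structures.
From mathcomp Require Import all_boot all_order all_algebra.
From mathcomp Require Import complex.
From mathcomp Require Import all_classical all_reals all_analysis.
From mathcomp Require Import zify ring lra.
Import Order.TTheory GRing.Theory Num.Theory.
Import numFieldNormedType.Exports.
Local Open Scope ring_scope.
Local Open Scope complex_scope.

(** * Growth of the central binomial coefficients *)

Lemma expn4_le_central_bin k : (4 ^ k <= k.*2.+1 * 'C(k.*2, k))%N.
Proof.
elim: k => [//|k IHk].
have E : (k.+1 * 'C(k.+1.*2, k.+1) = 2 * k.*2.+1 * 'C(k.*2, k))%N.
  have h1 : (k.+1 * 'C(k.*2.+2, k.+1) = k.*2.+2 * 'C(k.*2.+1, k))%N.
    by rewrite mul_bin_diag.
  have h2 : ((k.*2.+1 - k) * 'C(k.*2.+1, k) = k.*2.+1 * 'C(k.*2, k))%N.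
    by rewrite mul_bin_down.
  have h3 : (k.*2.+1 - k = k.+1)%N by lia.
  rewrite h3 in h2; rewrite doubleS; nia.
rewrite -(@leq_pmul2l k.+1)// expnS.
rewrite [X in (_ <= X)%N]mulnCA E.
have : (k.+1 * (4 * 4 ^ k) <= 4 * k.+1 * (k.*2.+1 * 'C(k.*2, k)))%N.
  by rewrite mulnA (mulnC _ 4%N) leq_mul2l IHk orbT.
move=> /leq_trans; apply.
rewrite [in leqRHS]mulnA mulnA leq_mul2r; apply/orP; right; nia.
Qed.

(** [(2 * r) ^+ k] equals [4 ^+ k * (r / 2) ^+ k], and [k.*2.+1%:R * (r / 2) ^+ k] tends to [0]. The
    factor [4] is the margin that later turns [rho] into [rho / 2]. *)
Lemma exists_expr_le_central_bin (R : realType) (r : R) : 0 <= r -> r < 2 ->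
  exists k, (2 * r) ^+ k * 4 <= 'C(k.*2, k)%:R.
Proof.
move=> r0 r2.
set s := Num.sqrt (r / 2).
have s0 : 0 <= s by exact: sqrtr_ge0.
have ss : s ^+ 2 = r / 2 by rewrite sqr_sqrtr// divr_ge0.
have s1 : s < 1.
  by rewrite -(@ltr_pXn2r _ 2)// ?nnegrE// ss expr1n; lra.
(* [k s^k <= 1 / (1 - s)], and the remaining factor [s^k] tends to 0. *)
have ksk n : n%:R * s ^+ n * (1 - s) <= 1.
  (* The added [s ^+ n] makes the left side nonincreasing in [n]: it drops by
     [(n%:R + 1) * s ^+ n * (1 - s) ^+ 2]. *)
  suff: n%:R * s ^+ n * (1 - s) + s ^+ n <= 1.
    by move=> ?; have := exprn_ge0 n s0; lra.
  elim: n => [|n IHn]; first by rewrite mul0r mul0r add0r expr0.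
  have := exprn_ge0 n s0 => sn0.
  apply: le_trans IHn; rewrite exprS -natr1.
  have : 0 <= (n%:R + 1) * s ^+ n * (1 - s) ^+ 2.
    by rewrite mulr_ge0 ?sqr_ge0// mulr_ge0// addr_ge0.
  lra.
(* The constant is [12] because [4 * (2 * k + 1) <= 12 * k] for [k >= 1]; hence also the choice
   [N.+1]. *)
have /cvgrPdist_le/(_ ((1 - s) / 12)) : (s ^+ n @[n --> \oo] --> (0 : R))%classic.
  by apply: cvg_expr; rewrite ger0_norm.
case; first by rewrite divr_gt0// subr_gt0.
move=> N _ /(_ N.+1 (leqnSn N)).
set k := N.+1; rewrite sub0r normrN ger0_norm ?exprn_ge0// => skle.
exists k.
have k1 : 1 <= k%:R :> R by rewrite ler1n.
have main : k.*2.+1%:R * (r / 2) ^+ k * 4 <= 1.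
  have sk0 := exprn_ge0 k s0.
  have h := ksk k.
  rewrite -ss -exprM mulnC exprM expr2 -addn1 natrD -muln2 natrM.
  have : k%:R * s ^+ k * s ^+ k <= k%:R * s ^+ k * ((1 - s) / 12).
    by rewrite ler_wpM2l// mulr_ge0.
  have : s ^+ k * s ^+ k <= k%:R * s ^+ k * s ^+ k.
    by rewrite ler_wpM2r// ler_peMl.
  lra.
have E : (2 * r) ^+ k = 4 ^+ k * (r / 2) ^+ k.
  by rewrite -exprMn; congr (_ ^+ _); field.
have B : 4 ^+ k <= k.*2.+1%:R * 'C(k.*2, k)%:R :> R.
  by rewrite -natrX -natrM ler_nat expn4_le_central_bin.
have rk0 : 0 <= (r / 2) ^+ k by rewrite exprn_ge0// divr_ge0.
rewrite E.
apply: (le_trans (y := k.*2.+1%:R * 'C(k.*2, k)%:R * (r / 2) ^+ k * 4)).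
  by rewrite ler_wpM2r// ler_wpM2r.
have : 0 <= 'C(k.*2, k)%:R :> R by [].
nra.
Qed.

(** * Finite differences of a cosine function *)

Lemma sum_pascal (V : nmodType) (a : nat -> V) n :
  \sum_(i < n.+2) a i *+ 'C(n.+1, i) =
  \sum_(i < n.+1) a i.+1 *+ 'C(n, i) + \sum_(i < n.+1) a i *+ 'C(n, i).
Proof.
rewrite big_ord_recl [in RHS]addrC [X in _ = X + _]big_ord_recl -addrA !bin0.
congr (_ + _).
under eq_bigr do rewrite lift0 binS mulrnDr.
rewrite big_split /=; congr (_ + _).
by rewrite big_ord_recr /= bin_small// mulr0n addr0.
Qed.

Section CosineAlgebra.
Variables (R : realType) (A : pzRingType) (C : R -> A).
Hypothesis hC : cosine_function C.

Lemma cosine0 : C 0 = 1. Proof. by case: hC. Qed.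

Lemma cosine_mul s t : (C s * C t) *+ 2 = C (s + t) + C (s - t).
Proof. by case: hC => _ ->; rewrite -mulrA mulr_natl. Qed.

Lemma cosineN t : C (- t) = C t.
Proof.
by have := cosine_mul 0 t; rewrite cosine0 mul1r add0r sub0r mulr2n => /addrI ->.
Qed.

Lemma cosine_defect_mul s u :
  (1 - C s) *+ 2 * C u = C u *+ 2 - C (u + s) - C (u - s).
Proof.
rewrite mulrnBl mulrBl !mulrnAl mul1r cosine_mul opprD addrA (addrC s).
by rewrite -(cosineN (s - u)) opprB.
Qed.

(** By [cosine_defect_mul], left multiplication by [(1 - C s) *+ 2] acts on values of [C] as minus a
    second central difference, so its [k]-th power is [(-1) ^+ k] times the difference of order
    [k.*2] based at [u - k%:R * s]. *)
Lemma cosine_defect_exp s k u :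
  ((1 - C s) *+ 2) ^+ k * C u =
  \sum_(i < k.*2.+1) (-1) ^+ (k + i) * C (u + (i%:R - k%:R) * s) *+ 'C(k.*2, i).
Proof.
(* [D n v] is the forward difference of [C] of order [n] at [v] with step [s]; [DS] is Pascal's
   rule. *)
have [D [DE D0 DS]] : exists D : nat -> R -> A, [/\
    forall n v, D n v = \sum_(i < n.+1) (-1) ^+ (n + i) * C (v + i%:R * s) *+ 'C(n, i),
    forall v, D 0 v = C v & forall n v, D n.+1 v = D n (v + s) - D n v].
  exists (fun n v => \sum_(i < n.+1) (-1) ^+ (n + i) * C (v + i%:R * s) *+ 'C(n, i)).
  split=> [//|v|n v].
    by rewrite big_ord_recl big_ord0 expr0 mul1r mul0r !addr0.
  rewrite (sum_pascal _ (fun i => (-1) ^+ (n.+1 + i) * C (v + i%:R * s))).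
  rewrite -sumrN; congr (_ + _); apply: eq_bigr => i _.
    by rewrite addSnnS addnS addnS !exprS mulrA mulrNN mul1r mul1r -addrA -natr1
      mulrDl mul1r (addrC s).
  by rewrite addSn exprS mulN1r mulNr mulNrn.
have XE w : ((1 - C s) *+ 2) ^+ k * C w = (-1) ^+ k * D k.*2 (w - k%:R * s).
  elim: k w => [|k' IHk] w.
    by rewrite !expr0 !mul1r mul0r subr0 D0.
  rewrite exprSr -mulrA cosine_defect_mul !mulrBr mulrnAr !IHk.
  rewrite doubleS !DS exprS mulN1r.
  have -> : w - k'.+1%:R * s + s = w - k'%:R * s by rewrite -natr1; ring.
  have -> : w - k'%:R * s + s = w + s - k'%:R * s by ring.
  have -> : w - k'.+1%:R * s = w - s - k'%:R * s by rewrite -natr1; ring.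
  rewrite mulNr -mulrN !opprB mulrDr !mulrBr mulr2n.
  by rewrite [RHS]addrACA [RHS]addrA [RHS]addrAC.
rewrite XE DE big_distrr/=; apply: eq_bigr => i _.
rewrite -mulrnAr mulrA -mulrnAr.
congr (_ * _).
  by rewrite -exprD addnCA exprD -signr_odd odd_double mul1r.
by rewrite mulrBl -addrA (addrC (- _)).
Qed.

End CosineAlgebra.

(** * Shifted sums and the real-valued norm *)

(** Each induction step on [a] adds one telescoping sum. The number of terms on the right does not
    grow with [M], whence the [O(1/M)] after averaging. *)
Lemma sum_shift_sub (V : zmodType) (g : nat -> V) a M :
  \sum_(j < M) (g (j + a)%N - g j) = \sum_(i < a) (g (M + i)%N - g i).
Proof.
elim: a => [|a IHa].
  by rewrite big_ord0 big1// => j _; rewrite addn0 subrr.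
rewrite big_ord_recr/= -IHa.
have := telescope_sumr (fun j => g (j + a)%N) (leq0n M).
rewrite big_mkord => <-; rewrite -big_split/=; apply: eq_bigr => j _.
by rewrite addnS addrC addrA subrK.
Qed.

Section CosineNorm.
Variables (R : realType) (A : banachAlgType R[i]).
Implicit Types x y : A.

Lemma rnorm_ge0 x : 0 <= rnorm x.
Proof. rewrite -lecR rnormE; exact: normr_ge0. Qed.

Lemma ler_rnormD x y : rnorm (x + y) <= rnorm x + rnorm y.
Proof. by rewrite -lecR rmorphD/= !rnormE ler_normD. Qed.

Lemma rnormN x : rnorm (- x) = rnorm x.
Proof. by rewrite /rnorm normrN. Qed.

Lemma rnorm0 : rnorm (0 : A) = 0.
Proof. by rewrite /rnorm normr0. Qed.

Lemma rnormMn x n : rnorm (x *+ n) = rnorm x *+ n.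
Proof. by apply: (@complexI R); rewrite rmorphMn/= !rnormE normrMn. Qed.

Lemma rnormMsign n x : rnorm ((-1) ^+ n * x) = rnorm x.
Proof. by rewrite -signr_odd; case: (odd n); rewrite ?mul1r// mulN1r rnormN. Qed.

Lemma ler_rnormM x y : rnorm (x * y) <= rnorm x * rnorm y.
Proof. by rewrite -lecR rmorphM/= !rnormE banach_normrM. Qed.

(* The exponent is positive because [rnorm 1] may exceed [1]. *)
Lemma ler_rnormX x n : rnorm (x ^+ n.+1) <= rnorm x ^+ n.+1.
Proof.
elim: n => [//|n IHn]; rewrite exprS [leRHS]exprS.
by apply: le_trans (ler_rnormM _ _) _; rewrite ler_wpM2l// rnorm_ge0.
Qed.

Lemma ler_rnorm_sum I (r : seq I) (P : pred I) (F : I -> A) :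
  rnorm (\sum_(i <- r | P i) F i) <= \sum_(i <- r | P i) rnorm (F i).
Proof.
elim/big_ind2 : _ => // [|x a y b xa yb]; first by rewrite rnorm0.
by apply: le_trans (ler_rnormD _ _) _; rewrite lerD.
Qed.

End CosineNorm.

(** * Estimates near [0] and their iteration *)

Section ZeroTwo.
Variables (R : realType) (A : banachAlgType R[i]) (C : R -> A).
Hypothesis hC : cosine_function C.

Section LocalBound.
Variables (d rho : R).
Hypothesis d_gt0 : 0 < d.
Hypothesis C_bound : forall t, `|t| < d -> rnorm (C t - 1) <= rho.

Lemma cosine_bound_ge0 : 0 <= rho.
Proof. by apply: le_trans (rnorm_ge0 _ _ _) (C_bound 0 _); rewrite normr0. Qed.

Lemma ler_rnorm_cosineB s t :
  `|s| < d -> `|t| < d -> rnorm (C s - C t) <= rho *+ 2.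
Proof.
move=> sd td; have -> : C s - C t = (C s - 1) - (C t - 1).
  by rewrite opprB addrA subrK.
apply: le_trans (ler_rnormD _ _ _ _) _; rewrite rnormN mulr2n.
by rewrite lerD// C_bound.
Qed.

(** Each summand is a difference over a shift by [a] ending at [j], minus the one starting at [j].
    Both sums reduce to [a] differences of values of [C], each of norm at most [rho *+ 2]. *)
Lemma ler_rnorm_defect_sum a M (v : R) : (M + a)%:R * `|v| < d ->
  rnorm (\sum_(j < M) (1 - C (a%:R * v)) *+ 2 * C (j%:R * v)) <= rho *+ (4 * a).
Proof.
move=> Mad.
have small (x : R) : `|x| <= (M + a)%:R -> `|x * v| < d.
  by move=> xMa; rewrite normrM; apply: le_lt_trans Mad; rewrite ler_wpM2r.
(* The subtraction is done in [R] because [j - a] may be negative. *)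
pose g j := C ((j%:R - a%:R) * v).
have gE j : g (j + a)%N = C (j%:R * v) by rewrite /g natrD addrK.
have -> : \sum_(j < M) (1 - C (a%:R * v)) *+ 2 * C (j%:R * v) =
    \sum_(j < M) (g (j + a)%N - g j) -
    \sum_(j < M) (C ((j + a)%:R * v) - C (j%:R * v)).
  rewrite -sumrB; apply: eq_bigr => j _.
  rewrite cosine_defect_mul// gE /g natrD.
  rewrite !mulrDl mulNr.
  rewrite opprB mulr2n.
  by rewrite [RHS]addrACA [RHS]addrA [RHS]addrAC.
rewrite (sum_shift_sub _ g) (sum_shift_sub _ (fun j => C (j%:R * v))).
have bnd (h1 h2 : nat -> R) : (forall i, (i < a)%N -> `|h1 i| <= (M + a)%:R) ->
    (forall i, (i < a)%N -> `|h2 i| <= (M + a)%:R) ->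
    rnorm (\sum_(i < a) (C (h1 i * v) - C (h2 i * v))) <= rho *+ (2 * a).
  move=> h1P h2P; apply: le_trans (ler_rnorm_sum _ _ _ _ _ _) _.
  apply: (@le_trans _ _ (\sum_(i < a) rho *+ 2)); first apply: ler_sum.
    by move=> i _; rewrite ler_rnorm_cosineB// small ?h1P ?h2P.
  by rewrite sumr_const card_ord mulrnA.
apply: le_trans (ler_rnormD _ _ _ _) _; rewrite rnormN.
rewrite -[4%N]/(2 + 2)%N mulnDl mulrnDr lerD//.
  apply: (bnd (fun i => (M + i)%:R - a%:R) (fun i => i%:R - a%:R)) => i ia.
    rewrite ler_norml; have : (i%:R : R) <= a%:R by rewrite ler_nat ltnW.
    have := ler0n R M; have := ler0n R i; rewrite !natrD; lra.
  rewrite ler_norml; have : (i%:R : R) <= a%:R by rewrite ler_nat ltnW.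
  have := ler0n R M; have := ler0n R i; rewrite !natrD; lra.
apply: (bnd (fun i => (M + i)%:R) (fun i => i%:R)) => i ia;
  by rewrite normr_nat ler_nat; lia.
Qed.

(** The averaged identity before division by [M]. The factor [k * (M + k!)] bounds every multiple of
    [t] at which [C] is estimated. *)
Lemma ler_rnorm_defect_fact k M t : (0 < k)%N -> (0 < M)%N ->
  (k * (M + k`!))%:R * `|t| < d ->
  rnorm (C (k`!%:R * t) - 1) *+ (2 * M * 'C(k.*2, k)) <=
    (rho *+ 2) ^+ k.+1 *+ M + rho *+ (4 * k`! * 4 ^ k).
Proof.
move=> k0 M0 ktd.
have rho0 := cosine_bound_ge0.
have small (n : nat) : (n <= k * (M + k`!))%N -> `|n%:R * t| < d.
  move=> nk; rewrite normrM normr_nat; apply: le_lt_trans ktd.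
  by rewrite ler_wpM2r// ler_nat.
pose y := (1 - C (k`!%:R * t)) *+ 2.
have y_le n : (n <= k * (M + k`!))%N -> rnorm ((1 - C (n%:R * t)) *+ 2) <= rho *+ 2.
  by move=> nk; rewrite rnormMn lerMn2r -rnormN opprB C_bound// small.
have powE j : y * ((1 - C (j%:R * t)) *+ 2) ^+ k =
    \sum_(i < k.*2.+1) (-1) ^+ (k + i) *
      (y * C ((i%:R - k%:R) * (j%:R * t))) *+ 'C(k.*2, i).
  have := cosine_defect_exp _ _ _ hC (j%:R * t) k 0.
  rewrite (cosine0 _ _ _ hC) mulr1 => ->; rewrite big_distrr/=.
  apply: eq_bigr => i _; rewrite add0r mulrnAr; congr (_ *+ _).
  rewrite -signr_odd; case: (odd _); rewrite ?mul1r// !mulN1r; exact: mulrN.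
have kk : (k < k.*2.+1)%N by lia.
(* [T i] collects the [i]-th terms of the expansions over all [j]. At [i = k] every argument of [C]
   is [0], so copies of [y] remain. *)
pose T (i : 'I_k.*2.+1) := (-1) ^+ (k + i) *
  (\sum_(j < M) y * C ((i%:R - k%:R) * (j%:R * t))) *+ 'C(k.*2, i).
have sumE : \sum_(j < M) y * ((1 - C (j%:R * t)) *+ 2) ^+ k = \sum_i T i.
  under eq_bigr do rewrite powE.
  rewrite exchange_big; apply: eq_bigr => i _.
  by rewrite /T big_distrr/= sumrMnl.
have Tk : T (Ordinal kk) = y *+ (M * 'C(k.*2, k)).
  rewrite /T /= subrr addnn -signr_odd odd_double mul1r.
  under eq_bigr do rewrite mul0r (cosine0 _ _ _ hC) mulr1.
  by rewrite sumr_const card_ord mulrnA.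
have T_le i : i != Ordinal kk -> rnorm (T i) <= rho *+ (4 * k`!) *+ 'C(k.*2, i).
  move=> ik; rewrite rnormMn lerMn2r rnormMsign; apply/orP; right.
  (* [m] is the distance from [i] to [k]; evenness of [C] absorbs the sign. *)
  have [m [m0 mk mE]] : exists m, [/\ (0 < m)%N, (m <= k)%N &
      forall x, C ((i%:R - k%:R) * x) = C (m%:R * x)].
    have := ltn_ord i; have : (i != k :> nat) by apply: contra ik => /eqP e; apply/eqP/val_inj.
    case: (ltnP i k) => [ltik _ _|leki neq lti].
      exists (k - i)%N; split; [lia|lia|move=> x].
      by rewrite -cosineN// -mulNr opprB natrB// ltnW.
    by exists (i - k)%N; split; [lia|lia|move=> x; rewrite natrB].
  (* Since k! is [a * m], [y] is the defect at [a%:R * (m%:R * t)], and [ler_rnorm_defect_sum]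
     applies with [v = m%:R * t]. *)
  have /dvdnP[a aE] : (m %| k`!)%N by rewrite dvdn_fact// m0.
  have a_le : (a <= k`!)%N by rewrite aE leq_pmulr.
  under eq_bigr => j _ do rewrite mE mulrCA.
  rewrite /y aE natrM -mulrA.
  apply: le_trans (ler_rnorm_defect_sum _ _ _ _) _.
    apply: le_lt_trans ktd; rewrite normrM normr_nat mulrA ler_wpM2r//.
    by rewrite -natrM ler_nat mulnC leq_mul// leq_add2l.
  by rewrite ler_wpMn2l// leq_mul2l leq_pmulr.
have main : rnorm y *+ (M * 'C(k.*2, k)) <=
    (rho *+ 2) ^+ k.+1 *+ M + rho *+ (4 * k`! * 4 ^ k).
  rewrite -rnormMn -Tk.
  have -> : T (Ordinal kk) = \sum_(j < M) y * ((1 - C (j%:R * t)) *+ 2) ^+ k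
      - \sum_(i | i != Ordinal kk) T i.
    by rewrite sumE (bigD1 (Ordinal kk))//= addrK.
  apply: le_trans (ler_rnormD _ _ _ _) _; rewrite rnormN lerD//.
    apply: le_trans (ler_rnorm_sum _ _ _ _ _ _) _.
    rewrite -[X in _ *+ X]card_ord -sumr_const; apply: ler_sum => j _.
    apply: le_trans (ler_rnormM _ _ _ _) _; rewrite exprS.
    apply: ler_pM; rewrite ?rnorm_ge0//.
      by apply: y_le; rewrite mulnDr -[leqLHS]add0n leq_add// leq_pmull.
    rewrite -(prednK k0); apply: le_trans (ler_rnormX _ _ _ _) _.
    rewrite lerXn2r ?nnegrE ?rnorm_ge0 ?mulrn_wge0// y_le//.
    have := ltn_ord j; nia.
  apply: le_trans (ler_rnorm_sum _ _ _ _ _ _) _.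
  apply: le_trans (ler_sum _ T_le) _.
  rewrite sumrMnr -mulrnA ler_wpMn2l// leq_mul2l; apply/orP; right.
  (* [4 ^ k] is expanded as [(1 + 1) ^ k.*2]; the sum on the left lacks only the central
     coefficient. *)
  rewrite -[4%N]/(2 * 2)%N mulnn -expnM mul2n -[2%N]/(1 + 1)%N Pascal.
  rewrite [leqRHS](eq_bigr (fun i : 'I_k.*2.+1 => 'C(k.*2, i))); last first.
    by move=> i _; rewrite !exp1n !muln1.
  by rewrite [leqRHS](bigD1 (Ordinal kk))//= leq_addl.
by move: main; rewrite rnormMn -mulrnA -rnormN opprB mulnA.
Qed.

End LocalBound.

(* The constant depends on [r] only: the estimate can be iterated. *)
Lemma cosine_bound_halving (r : R) : r < 2 -> exists2 K : R, 0 < K &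
  forall d rho, 0 < d -> rho <= r ->
    (forall t, `|t| < d -> rnorm (C t - 1) <= rho) ->
  forall t, `|t| < d / K -> rnorm (C t - 1) <= rho / 2.
Proof.
move=> r2.
have [r0|r0] := ltP r 0.
  exists 1 => // d rho d0 rhor Cb.
  by have := cosine_bound_ge0 d rho d0 Cb; lra.
have [k kP] := exists_expr_le_central_bin R r r0 r2.
case: k kP => [|k'] kP; first by move: kP; rewrite expr0 mul1r lern1.
move: k'.+1 (ltn0Sn k') kP => k k0 kP.
have B := expn4_le_central_bin k.
have B0 : (0 < 'C(k.*2, k))%N by rewrite bin_gt0 -addnn leq_addr.
(* With this [M], [expn4_le_central_bin] bounds the boundary term [rho *+ (4 * k! * 4 ^ k)] by half
   of [rho * (M * 'C(k.*2, k))%:R]; [pow_le] gives the other half to the power term. *)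
set M := (8 * k`! * k.*2.+1)%N.
have M0 : (0 < M)%N by rewrite !muln_gt0 fact_gt0.
exists (k * (M + k`!))%:R.
  by rewrite ltr0n muln_gt0 k0 addn_gt0 M0.
move=> d rho d0 rhor Cb t td.
have rho0 := cosine_bound_ge0 d rho d0 Cb.
have f0 : k`!%:R != 0 :> R by rewrite pnatr_eq0 -lt0n fact_gt0.
(* Dividing [t] by k! makes the defect being estimated the one at [t] itself. *)
have := ler_rnorm_defect_fact d rho d0 Cb k M (t / k`!%:R) k0 M0.
rewrite mulrCA divff// mulr1 => main.
have {main} := main _; case: (boolP (_ < d)) => [_ /(_ isT) main|/negP nd _]; last first.
  case: nd; move: td; rewrite ltr_pdivlMr ?ltr0n ?muln_gt0 ?k0 ?addn_gt0 ?M0//.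
  apply: le_lt_trans; rewrite mulrC ler_wpM2r// normrM normfV normr_nat.
  by rewrite ler_piMr// invf_le1 ?ltr0n ?fact_gt0// ler1n fact_gt0.
have MB0 : 0 < (M * 'C(k.*2, k))%:R :> R by rewrite ltr0n muln_gt0 M0.
have pow_le : (rho *+ 2) ^+ k.+1 *+ M <= rho * (M * 'C(k.*2, k))%:R / 2.
  have : (rho *+ 2) ^+ k <= 'C(k.*2, k)%:R / 4.
    rewrite ler_pdivlMr//; apply: le_trans kP; rewrite ler_pM2r// -mulr_natl.
    by apply: lerXn2r; rewrite ?nnegrE ?mulr_ge0//; lra.
  rewrite exprS -[_ *+ M]mulr_natr natrM -[rho *+ 2]mulr_natr => le4.
  have : rho * 2 * (rho * 2) ^+ k <= rho * 2 * ('C(k.*2, k)%:R / 4).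
    by rewrite ler_wpM2l ?mulr_ge0.
  have : 0 < M%:R :> R by rewrite ltr0n.
  nra.
have sum_le : rho *+ (4 * k`! * 4 ^ k) <= rho * (M * 'C(k.*2, k))%:R / 2.
  rewrite ler_pdivlMr// -[rho *+ _]mulr_natr -mulrA -natrM ler_wpM2l// ler_nat.
  by rewrite /M; nia.
move: main; rewrite -mulnA mulrnA -[_ *+ (M * _)]mulr_natr -[_ *+ 2]mulr_natr.
by move=> main; rewrite -(ler_pM2r MB0); lra.
Qed.

(** Every bound [r / 2 ^+ n] stays at most [r], so the same [K] serves at each halving. *)
Lemma cosine_bound_geometric (r d : R) : r < 2 -> 0 < d ->
    (forall t, `|t| < d -> rnorm (C t - 1) <= r) ->
  forall n, exists2 e, 0 < e &
    forall t, `|t| < e -> rnorm (C t - 1) <= r / 2 ^+ n.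
Proof.
move=> r2 d0 Cr; have r0 := cosine_bound_ge0 _ _ d0 Cr.
have [K K0 halve] := cosine_bound_halving _ r2.
elim=> [|n [e e0 Ce]]; first by exists d => // t; rewrite expr0 divr1; exact: Cr.
exists (e / K); first by rewrite divr_gt0.
rewrite exprSr invfM mulrA => t te.
apply: (halve e) => //.
by rewrite ler_pdivrMr ?exprn_gt0// ler_peMr// exprn_ege1// ler1n.
Qed.

End ZeroTwo.

(** * From the upper limit to a local bound and back *)

Theorem theorem3p2 (R : realType) (A : banachAlgType R[i]) (C : R -> A)
    (hC : cosine_function C)
    (hlt2 : (lime_sup (fun t : R => (rnorm (C t - 1))%:E) 0 < 2%:E)%E) :
  lime_sup (fun t : R => (rnorm (C t - 1))%:E) 0 = 0%E.
Proof.
have [r r2 [d d0 Cr]] : exists2 r, r < 2 & exists2 d, 0 < d &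
    forall t, `|t| < d -> rnorm (C t - 1) <= r.
  move: hlt2; rewrite lime_supE.
  move=> /ereal_inf_lt[_ [d /= + <-] dlt]; rewrite in_itv/= andbT => d0.
  set S := ereal_sup _ in dlt.
  have ub t : t != 0 -> `|t| < d -> ((rnorm (C t - 1))%:E <= S)%E.
    move=> t0 td; apply: ereal_sup_ubound; exists t => //; split; last exact/eqP.
    by rewrite /ball/= sub0r normrN.
  (* The point [d / 2] of the punctured ball forces [0 <= S]; with [S < 2] this makes [S] a real
     number. *)
  have d2 : `|d / 2| < d by rewrite ger0_norm; lra.
  have S0 : (0 <= S)%E.
    by apply: le_trans (ub _ _ d2); rewrite ?lee_fin ?rnorm_ge0// gt_eqF// divr_gt0.
  have Sfin : S \is a fin_num by rewrite fin_numElt (lt_le_trans _ S0)//= (lt_trans dlt)// ltry.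
  exists (fine S); first by rewrite -lte_fin fineK.
  exists d => // t td; rewrite -lee_fin fineK//.
  (* The upper limit is over punctured balls, so [t = 0] is settled by [C 0 = 1]. *)
  have [->|t0] := eqVneq t 0; last exact: ub.
  by rewrite (cosine0 _ _ _ hC) subrr rnorm0.
(* It suffices that the norm has limit [0]. *)
apply: lim_lime_sup; apply/fine_cvgP; split; first exact: nearW.
apply/cvgrPdist_le => eps eps0.
have [n nP] : exists n, r / 2 ^+ n <= eps.
  have half1 : `|2^-1 : R| < 1 by rewrite gtr0_norm; lra.
  have /cvgrPdist_le/(_ _ eps0)[n _ /(_ n (leqnn n))] := @cvg_geometric R r _ half1.
  rewrite sub0r normrN /geometric/= exprVn => rn.
  by exists n; apply: le_trans rn; exact: ler_norm.
have [e e0 Ce] := cosine_bound_geometric _ _ _ hC _ _ r2 d0 Cr n.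
exists e => //= t; rewrite /ball/= !sub0r !normrN => /Ce h.
by rewrite ger0_norm ?rnorm_ge0// (le_trans h).
Qed.
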